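(* Let $\mathcal{X}\subseteq\mathbb{R}^{n_X}$, $\mathcal{Y}=\{0,1\}$, and let $p$ be a probability distribution on $\mathcal{X}\times\mathcal{Y}$. Let $\Delta=\{\delta\in\mathbb{R}^{n_X}\mid A\delta+b\ge 0\}$ (with $A\in\mathbb{R}^{k\times n_X}$, $b\in\mathbb{R}^k$) be a polytope with $0\in\Delta$, let $g_\theta:\mathcal{X}\to[0,1]$ be a fixed (pretrained) measurable scoring function that is differentiable almost everywhere, and let $\mathcal{A}:\mathcal{X}\to\Delta$ be a fixed measurable map (the algorithm for computing recourse) with $x+\mathcal{A}(x)\in\mathcal{X}$ for all $x\in\mathcal{X}$. Let $\epsilon,\alpha\in\mathbb{R}_{>0}$, let $N\ge 1$, and let $\hat\tau:(\mathcal{X}\times\mathcal{Y})^N\to[0,1]$ be a PAC confidence set threshold estimator for $g_\theta$ at confidence levels $(\epsilon,\alpha)$, as defined in the context. Given a calibration dataset $Z=((x_1,y_1),\dots,(x_N,y_N))$ of i.i.d. samples from $p$, define $$Z'=\big((x_1+\mathcal{A}(x_1),1),\dots,(x_N+\mathcal{A}(x_N),1)\big),\qquad \hat\theta_0(Z)=\hat\tau(Z'),$$ and let $f_{\hat\theta(Z)}:\mathcal{X}\to\mathcal{Y}$ be the classifier $f_{\hat\theta(Z)}(x)=\mathbb{1}\big(g_\theta(x)\ge\hat\theta_0(Z)\big)$. Then $\hat\theta$ satisfies the PARE (Probably Approximately has REcourse) condition at levels $(\epsilon,\alpha)$, i.e. $$\mathbb{P}_{Z\sim p^{N}}\Big[\,\mathbb{P}_{x\sim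 p(x)}\big[x\in\mathcal{X}^R_{\hat\theta(Z)}\big]\ge 1-\epsilon\,\Big]\ge 1-\alpha,$$ where $p(x)$ is the marginal of $p$ on $\mathcal{X}$ and $\mathcal{X}^R_{\hat\theta(Z)}$ is the set of inputs that have recourse under $f_{\hat\theta(Z)}$ with respect to $\Delta$.
   Context: Recourse: for a classifier $f:\mathcal{X}\to\{0,1\}$ and a set $\Delta\subseteq\mathbb{R}^{n_X}$ of permissible changes, an input $x\in\mathcal{X}$ has recourse if there exists $\delta\in\Delta$ (with $x+\delta\in\mathcal{X}$) such that $f(x+\delta)=1$. For a classifier $f_\theta$, $\mathcal{X}^R_\theta$ denotes the set of $x\in\mathcal{X}$ that have recourse under $f_\theta$. Approximate recourse and PARE: parameters $\theta$ (including the decision threshold) approximately have recourse, at level $\epsilon$, if $\mathbb{P}_{p(x)}[x\in\mathcal{X}^R_\theta]\ge 1-\epsilon$. An estimator $\hat\theta$, mapping a calibration dataset $Z$ of i.i.d. samples from $p$ to parameters $\hat\theta(Z)$, Probably Approximately has REcourse (PARE) at levels $(\epsilon,\alpha)$ if $\mathbb{P}_{p(Z)}[\hat\theta(Z)\text{ approximately has recourse}]\ge 1-\alpha$, where $p(Z)$ is the product distribution. Here $\hat\theta(Z)$ consists of the given parameters $\theta$ of $g_\theta$ together with the decision threshold $\hat\theta_0(Z)$. PAC confidence set threshold estimator: for $\tau\in\mathbb{R}$ define the set-valued predictor $\tilde h_{\theta,\tau}(x)=\{y\in\mathcal{Y}\mid h_\theta(x,y)\ge\tau\}$, where $h_\theta(x,1)=g_\theta(x)$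 and $h_\theta(x,0)=1-g_\theta(x)$. For a distribution $q$ on $\mathcal{X}\times\mathcal{Y}$, $\tau$ is called approximately correct for $q$ (at level $\epsilon$) if $\mathbb{P}_{(x,y)\sim q}[y\in\tilde h_{\theta,\tau}(x)]\ge 1-\epsilon$. A measurable map $\hat\tau:(\mathcal{X}\times\mathcal{Y})^N\to[0,1]$ is a PAC confidence set threshold estimator for $g_\theta$ at levels $(\epsilon,\alpha)$ if for every probability distribution $q$ on $\mathcal{X}\times\mathcal{Y}$, when $W$ consists of $N$ i.i.d. samples from $q$, $\mathbb{P}_{W\sim q^N}[\hat\tau(W)\text{ is approximately correct for }q]\ge 1-\alpha$. All sets, maps and events are assumed measurable as needed for the probabilities to make sense. $\mathbb{1}(\cdot)$ denotes the indicator function. *)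

(* Defs.v *)
From HB Require Import structures.
From mathcomp Require Import all_boot all_order all_algebra.
From mathcomp Require Import all_classical all_reals all_analysis.

Set Implicit Arguments.
Unset Strict Implicit.
Unset Printing Implicit Defensive.

Import Order.TTheory GRing.Theory Num.Theory.
Import numFieldNormedType.Exports.

Local Open Scope classical_set_scope.
Local Open Scope ring_scope.

(* The sigma-algebra on matrices generated by the entry maps; on 'cV[R]_n it
   is the Borel sigma-algebra of R^n. *)
Definition mx_cylinders (R : realType) (m n : nat) : set (set 'M[R]_(m, n)) :=
  [set C | exists (i : 'I_m) (j : 'I_n) (B : set R),
     measurable B /\ C = [set M : 'M[R]_(m, n) | B (M i j)]].

HB.instance Definition _ (R : realType) (m n : nat) :=
  @isMeasurable.Build (sigma_display (@mx_cylinders R m n)) 'M[R]_(m, n)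
    <<s @mx_cylinders R m n >> (@sigma_algebra0 _ setT _) (@sigma_algebraC _ _)
    (@sigma_algebra_bigcup _ _ _).

Section product_power.
Local Open Scope ereal_scope.
Context d (T : measurableType d) (R : realType).

Definition tuple_cons (n : nat) (x : T * n.-tuple T) : n.+1.-tuple T :=
  [tuple of x.1 :: x.2].

Definition tuple_uncons (n : nat) (t : n.+1.-tuple T) : T * n.-tuple T :=
  (thead t, [tuple of behead t]).

Lemma tuple_consK n : cancel (@tuple_cons n) (@tuple_uncons n).
Proof.
move=> [x t]; rewrite /tuple_cons /tuple_uncons /= theadE.
by congr pair; apply: val_inj.
Qed.

Lemma measurable_tuple_cons n : measurable_fun [set: _] (@tuple_cons n).
Proof. exact: measurable_cons. Qed.

Lemma measurable_tuple_uncons n : measurable_fun [set: _] (@tuple_uncons n).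
Proof.
apply/measurable_fun_pair; last exact: measurable_behead.
exact: measurable_tnth.
Qed.

Section step.
Variable (n : nat).
Variables (mu : {sigma_finite_measure set T -> \bar R}).
Variables (nu : {sigma_finite_measure set (n.-tuple T) -> \bar R}).

Definition product_cons : set (n.+1.-tuple T) -> \bar R :=
  pushforward (mu \x nu) (@tuple_cons n).

Let product_cons0 : product_cons set0 = 0.
Proof. by rewrite /product_cons /pushforward preimage_set0 measure0. Qed.

Let product_cons_ge0 A : 0 <= product_cons A.
Proof. exact: (@measure_ge0 _ _ _ (mu \x nu)). Qed.

Let product_cons_sigma_additive : semi_sigma_additive product_cons.
Proof.
have mcons A : measurable A -> measurable (@tuple_cons n @^-1` A).
  by rewrite -[X in _ -> measurable X]setTI; exact: measurable_tuple_cons.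
move=> F mF tF mUF; rewrite /product_cons /pushforward preimage_bigcup.
apply: measure_semi_sigma_additive => [k||]; first exact: mcons.
- apply/trivIsetP => /= i j _ _ ij; rewrite -preimage_setI.
  by move/trivIsetP : tF => /(_ _ _ _ _ ij) ->//; rewrite preimage_set0.
- by rewrite -preimage_bigcup; exact: mcons.
Qed.

HB.instance Definition _ := isMeasure.Build _ _ _ product_cons
  product_cons0 product_cons_ge0 product_cons_sigma_additive.

Let product_cons_sigma_finite : sigma_finite setT product_cons.
Proof.
have /sigma_finiteP[F [TF ndF Foo]] := sigma_finiteT mu.
have /sigma_finiteP[G [TG ndG Goo]] := sigma_finiteT nu.
have consK (B : set (T * n.-tuple T)%type) :
    @tuple_cons n @^-1` (@tuple_uncons n @^-1` B) = B.
  by apply/seteqP; split => x /=; rewrite tuple_consK.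
exists (fun k => @tuple_uncons n @^-1` (F k `*` G k)).
  rewrite -preimage_bigcup (_ : \bigcup_k _ = setT) ?preimage_setT//.
  apply/seteqP; split => // -[x t] _.
  have : [set: T] x by []; rewrite TF => -[k _ Fkx].
  have : [set: n.-tuple T] t by []; rewrite TG => -[l _ Glt].
  exists (maxn k l) => //; split => /=.
    by move: x Fkx; exact/subsetPset/ndF/leq_maxl.
  by move: t Glt; exact/subsetPset/ndG/leq_maxr.
move=> k; have [mF Fk] := Foo k; have [mG Gk] := Goo k; split.
  rewrite -[X in measurable X]setTI; apply: measurable_tuple_uncons => //.
  exact: measurableX.
rewrite /product_cons /pushforward consK product_measure1E//.
by rewrite lte_mul_pinfty// ge0_fin_numE.
Qed.

HB.instance Definition _ := Measure_isSigmaFinite.Build _ _ _ product_cons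
  product_cons_sigma_finite.

End step.

(* The n-fold product measure on n.-tuple T. *)
Fixpoint product_power (mu : {sigma_finite_measure set T -> \bar R}) (n : nat) :
    {sigma_finite_measure set (n.-tuple T) -> \bar R} :=
  if n is m.+1 then product_cons mu (product_power mu m)
  else dirac (nil_tuple T).

Lemma product_power_box (mu : {sigma_finite_measure set T -> \bar R}) (n : nat)
    (B : 'I_n -> set T) : (forall i, measurable (B i)) ->
  product_power mu n [set t | forall i, B i (tnth t i)] =
  \prod_(i < n) mu (B i).
Proof.
elim: n B => [|n IHn] B mB /=.
  by rewrite big_ord0 diracE mem_set// => -[].
rewrite big_ord_recl -IHn// /product_cons /pushforward -product_measure1E//.
  congr (_ _); apply/seteqP; split => -[x t] /= xt.
    split; first by have := xt ord0; rewrite tnth0.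
    by move=> i; have := xt (lift ord0 i); rewrite tnthS.
  move=> i; case: (unliftP ord0 i) => [j ->|->].
    by rewrite tnthS; exact: xt.2.
  by rewrite tnth0; exact: xt.1.
rewrite (_ : mkset _ = \bigcap_(i in [set: 'I_n])
    ((fun t => tnth t i) @^-1` B (lift ord0 i))); last first.
  by apply/seteqP; split => t /= tB i => [_|]; exact: tB.
apply: fin_bigcap_measurable => // i _.
by rewrite -[X in measurable X]setTI; exact: measurable_tnth.
Qed.

End product_power.

Arguments product_power {d T R} mu n.

Section almost_everywhere_differentiable.
Context (R : realType) (n : nat).

(* Differentiability relative to X: on the interior of X it is the usual one,
   and the values of g outside X play no role. *)
Definition differentiable_in (X : set 'cV[R]_n) (g : 'cV[R]_n -> R)
    (x : 'cV[R]_n) : Prop :=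
  exists G : 'rV[R]_n, forall e : R, 0 < e ->
    \forall y \near within X (nbhs x),
      `|g y - g x - (G *m (y - x)) ord0 ord0| <= e * `|y - x|.

Definition ae_differentiable (X : set 'cV[R]_n) (g : 'cV[R]_n -> R) : Prop :=
  {ae product_power (@lebesgue_measure R) n, forall t : n.-tuple R,
     let x := \col_i tnth t i in X x -> differentiable_in X g x}.

End almost_everywhere_differentiable.

Section recourse.
Context (R : realType) (n : nat).
Implicit Types (X Delta : set 'cV[R]_n).

(* The input space is a measurable set X : set 'cV[R]_n. A distribution on
   X * {0,1} is a probability on 'cV[R]_n * bool giving mass 1 to
   X `*` setT; functions defined on X are total functions of which only the
   restriction to X matters. *)
Local Notation example := ('cV[R]_n * bool)%type.

Definition supported_on X (q : probability example R) : Prop :=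
  q (X `*` [set: bool]) = 1%E.

Definition marginal (q : probability example R) : set 'cV[R]_n -> \bar R :=
  pushforward q fst.

Definition datasets X (N : nat) : set (N.-tuple example) :=
  [set Z | forall i, X (tnth Z i).1].
Arguments datasets X N : clear implicits.

Definition polyhedron (k : nat) (M : 'M[R]_(k, n)) (b : 'cV[R]_k) :
    set 'cV[R]_n :=
  [set delta | forall i, 0 <= (M *m delta + b) i ord0].

Definition has_recourse X Delta (f : 'cV[R]_n -> bool) (x : 'cV[R]_n) : Prop :=
  exists delta, [/\ Delta delta, X (x + delta) & f (x + delta) = true].

Definition recourse_set X Delta (f : 'cV[R]_n -> bool) : set 'cV[R]_n :=
  [set x | X x /\ has_recourse X Delta f x].

Definition approximately_has_recourse X Delta (p : probability example R)
    (eps : R) (f : 'cV[R]_n -> bool) : Prop :=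
  ((1 - eps)%:E <= marginal p (recourse_set X Delta f))%E.

Definition PARE X Delta (p : probability example R) (eps alpha : R)
    (Param : Type) (f : Param -> 'cV[R]_n -> bool) (N : nat)
    (thetahat : N.-tuple example -> Param) : Prop :=
  ((1 - alpha)%:E <= product_power p N
     (datasets X N `&`
      [set Z | approximately_has_recourse X Delta p eps (f (thetahat Z))]))%E.

Definition label_score (g : 'cV[R]_n -> R) (x : 'cV[R]_n) (y : bool) : R :=
  if y then g x else 1 - g x.

Definition confidence_set (g : 'cV[R]_n -> R) (t : R) (x : 'cV[R]_n) :
    set bool :=
  [set y | t <= label_score g x y].

Definition approximately_correct X (g : 'cV[R]_n -> R) (eps : R)
    (q : probability example R) (t : R) : Prop :=
  ((1 - eps)%:E <= q [set xy | X xy.1 /\ confidence_set g t xy.1 xy.2])%E.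

Definition PAC_threshold_estimator X (g : 'cV[R]_n -> R) (eps alpha : R)
    (N : nat) (tauhat : N.-tuple example -> R) : Prop :=
  [/\ measurable_fun (datasets X N) tauhat,
      (forall W, datasets X N W -> 0 <= tauhat W <= 1) &
      forall q : probability example R, supported_on X q ->
        ((1 - alpha)%:E <= product_power q N
           (datasets X N `&`
            [set W | approximately_correct X g eps q (tauhat W)]))%E].

Definition recourse_dataset (A : 'cV[R]_n -> 'cV[R]_n) (N : nat)
    (Z : N.-tuple example) : N.-tuple example :=
  map_tuple (fun xy => (xy.1 + A xy.1, true)) Z.

(* A parameter is a pair of a model parameter and a decision threshold. *)
Definition threshold_classifier (Theta : Type) (g : Theta -> 'cV[R]_n -> R)
    (th : Theta * R) (x : 'cV[R]_n) : bool :=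
  th.2 <= g th.1 x.

Definition recourse_estimator (Theta : Type) (theta : Theta)
    (A : 'cV[R]_n -> 'cV[R]_n) (N : nat) (tauhat : N.-tuple example -> R)
    (Z : N.-tuple example) : Theta * R :=
  (theta, tauhat (recourse_dataset A Z)).

End recourse.

Arguments datasets {R n} X N.

(* Main.v *)
(* Let phi (x, y) = (x + A x, 1) and q the image of p under phi. The translated
   dataset Z' is an i.i.d. sample from q, so the PAC guarantee for q says that
   with probability at least 1 - alpha over Z the threshold t = tauhat Z'
   satisfies q [t <= h (x, y)] >= 1 - eps, that is p [t <= g (x + A x)] >=
   1 - eps; and A x is then a permissible change giving x recourse. *)

Require Import Defs.
From mathcomp Require Import all_boot all_order all_algebra.
From mathcomp Require Import all_classical all_reals all_analysis.
From mathcomp Require Import measurable_realfun.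

Set Implicit Arguments.
Unset Strict Implicit.
Unset Printing Implicit Defensive.

Import Order.TTheory GRing.Theory Num.Theory.
Import numFieldNormedType.Exports.

Local Open Scope classical_set_scope.
Local Open Scope ring_scope.

(** Serves to turn the recourse shift, measurable only on [X], into a total measurable map. *)
Lemma measurable_fun_patch d d' (T : measurableType d) (U : measurableType d')
    (D : set T) (f g : T -> U) : measurable D ->
  measurable_fun D f -> measurable_fun [set: T] g ->
  measurable_fun [set: T] (patch g D f).
Proof.
move=> mD mf mg; apply: measurable_fun_if => //.
- apply: (measurable_fun_bool true); rewrite setTI (_ : _ @^-1` _ = D)//.
  by apply/seteqP; split => x; [exact: set_mem|exact: mem_set].
- by apply: measurable_funS mf => // x [_]; exact: set_mem.
- exact: measurable_funTS.
Qed.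

Lemma measurable_entry (R : realType) (m n : nat) (i : 'I_m) (j : 'I_n) :
  measurable_fun [set: 'M[R]_(m, n)] (fun M => M i j).
Proof.
move=> _ B mB; rewrite setTI; apply: sub_sigma_algebra.
by exists i, j, B.
Qed.

Lemma measurable_fun_mx d (T : measurableType d) (R : realType) (m n : nat)
    (D : set T) (mD : measurable D) (f : T -> 'M[R]_(m, n)) :
  (forall i j, measurable_fun D (fun x => f x i j)) -> measurable_fun D f.
Proof.
move=> mf; apply: (measurability (@mx_cylinders R m n)) => //.
by move=> _ [_ [i [j [B [mB ->]]]] <-]; exact: (mf i j mD _ mB).
Qed.

Lemma measurable_fun_addmx d (T : measurableType d) (R : realType) (m n : nat)
    (D : set T) (mD : measurable D) (f g : T -> 'M[R]_(m, n)) :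
  measurable_fun D f -> measurable_fun D g ->
  measurable_fun D (fun x => f x + g x).
Proof.
move=> mf mg; apply: measurable_fun_mx => // i j.
under eq_fun do rewrite mxE.
by apply: measurable_funD; apply: (measurableT_comp (measurable_entry i j)).
Qed.

Lemma measurable_map_tuple d d' (T : measurableType d) (U : measurableType d')
    (f : T -> U) (n : nat) : measurable_fun [set: T] f ->
  measurable_fun [set: n.-tuple T] (map_tuple f).
Proof.
move=> mf; apply/measurable_fun_tnthP => i.
rewrite (_ : _ \o _ = f \o (fun t => tnth t i)); last first.
  by apply/funext => t /=; rewrite tnth_map.
exact: measurableT_comp (measurable_tnth i).
Qed.

(** By induction on [n]: a change of variables turns the outer integral into one against [p], and
    the inner measures of sections agree by the induction hypothesis. This is what makes the
    translated dataset an i.i.d. sample from the image distribution. *)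
Lemma product_power_distribution d d' (T : measurableType d)
    (U : measurableType d') (R : realType) (p : probability T R)
    (f : {mfun T >-> U}) (n : nat) (E : set (n.-tuple U)) : measurable E ->
  product_power (distribution p f) n E =
  product_power p n (map_tuple f @^-1` E).
Proof.
elim: n E => [|n IHn] E mE /=.
  rewrite !diracE; congr (_%:R%:E); congr nat_of_bool.
  apply/idP/idP; rewrite !inE /=; rewrite (_ : map_tuple _ _ = nil_tuple U) //;
  exact: val_inj.
rewrite /product_cons /pushforward /product_measure1.
have mcE : measurable (@tuple_cons _ U n @^-1` E).
  by rewrite -[X in measurable X]setTI; exact: measurable_tuple_cons.
rewrite ge0_integral_distribution//; last exact: measurable_fun_xsection.
apply: eq_integral => x _ /=.
rewrite IHn; last exact: measurable_xsection.
congr (product_power p n _); apply/seteqP; split => t;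
  rewrite /= /xsection /= !inE /=;
  by rewrite (_ : map_tuple f (tuple_cons _) = tuple_cons (f x, map_tuple f t)) //;
     apply: val_inj.
Qed.

Lemma measurable_datasets (R : realType) (n N : nat) (X : set 'cV[R]_n) :
  measurable X -> measurable (datasets X N).
Proof.
move=> mX; rewrite (_ : datasets X N = \bigcap_(i in [set: 'I_N])
    ((fun Z => tnth Z i) @^-1` (fst @^-1` X))); last first.
  by apply/seteqP; split => Z /= XZ i => [_|]; exact: XZ.
apply: fin_bigcap_measurable => // i _.
rewrite -[X in measurable X]setTI; apply: measurable_tnth => //.
by rewrite -[X in measurable X]setTI; exact: measurable_fst.
Qed.

(** A down-closed set of reals is an interval. This yields measurability of sets of thresholds
    defined by monotone conditions. *)
Lemma measurable_down_closed (R : realType) (S : set R) :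
  (forall s t : R, s <= t -> S t -> S s) -> measurable S.
Proof.
move=> dS; apply: is_interval_measurable => x y Sx Sy z /andP[_ zy].
exact: dS Sy.
Qed.

(** Splitting by label gives two measurable rectangles, over the sets [t <= g x] and [t <= 1 - g x]
    within [X]. *)
Lemma measurable_confidence_event (R : realType) (n : nat) (X : set 'cV[R]_n)
    (g : 'cV[R]_n -> R) (t : R) : measurable X -> measurable_fun X g ->
  measurable [set xy : 'cV[R]_n * bool |
    X xy.1 /\ confidence_set g t xy.1 xy.2].
Proof.
move=> mX mg.
have m1 : measurable (X `&` [set x | t <= g x]).
  rewrite (_ : [set x | _] = g @^-1` `[t, +oo[); first exact: mg.
  by apply/seteqP; split => x /=; rewrite in_itv /= andbT.
have m0 : measurable (X `&` [set x | t <= 1 - g x]).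
  rewrite (_ : [set x | _] = (fun x => 1 - g x) @^-1` `[t, +oo[).
    by apply: measurable_funB.
  by apply/seteqP; split => x /=; rewrite in_itv /= andbT.
rewrite (_ : mkset _ = ((X `&` [set x | t <= g x]) `*` [set true]) `|`
    ((X `&` [set x | t <= 1 - g x]) `*` [set false])).
  by apply: measurableU; apply: measurableX.
apply/seteqP; split => -[x []] /=; rewrite /confidence_set /label_score /=.
- by move=> [Xx h]; left.
- by move=> [Xx h]; right.
- by case=> [[[]]|[]].
- by case=> [[_]|[[]]].
Qed.

(** Lowering the threshold enlarges every confidence set, hence the coverage. *)
Lemma approximately_correct_down (R : realType) (n : nat) (X : set 'cV[R]_n)
    (g : 'cV[R]_n -> R) (eps : R) (q : probability ('cV[R]_n * bool)%type R)
    (s t : R) : measurable X -> measurable_fun X g -> s <= t ->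
  approximately_correct X g eps q t -> approximately_correct X g eps q s.
Proof.
move=> mX mg st; rewrite /approximately_correct => /le_trans; apply.
apply: le_measure; rewrite ?inE; try exact: measurable_confidence_event.
by move=> xy [? /(le_trans st)].
Qed.

(* Raising the threshold shrinks the recourse set, so the good thresholds form
   a down-closed set relative to the attained ones. *)
Lemma measurable_good_datasets (R : realType) (n N : nat)
    (X Delta : set 'cV[R]_n) (p : probability ('cV[R]_n * bool)%type R)
    (eps : R) (Theta : Type) (g : Theta -> 'cV[R]_n -> R) (theta : Theta)
    (tau : N.-tuple ('cV[R]_n * bool)%type -> R) :
  measurable X -> measurable_fun (datasets X N) tau ->
  (forall Z, datasets X N Z ->
     measurable (recourse_set X Delta (threshold_classifier g (theta, tau Z)))) ->
  measurable (datasets X N `&` [set Z | approximately_has_recourse X Delta p eps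
    (threshold_classifier g (theta, tau Z))]).
Proof.
move=> mX mtau mrec.
pose good t := approximately_has_recourse X Delta p eps
  (threshold_classifier g (theta, t)).
(* The down-closure of the attained good thresholds. Values of [good] are compared only at attained
   thresholds, where [mrec] makes the recourse sets measurable. *)
pose S := [set t | exists2 Z, datasets X N Z & t <= tau Z /\ good (tau Z)].
have mS : measurable S.
  by apply: measurable_down_closed => s t st [Z XZ [/(le_trans st)]]; exists Z.
rewrite (_ : _ `&` _ = datasets X N `&` tau @^-1` S).
  by apply: mtau => //; exact: measurable_datasets.
apply/seteqP; split => Z [XZ] /=; first by move=> gZ; split => //; exists Z => //; split.
(* Goodness passes from [Z'] to [Z]: a change giving recourse at the higher threshold [tau Z'] still
   does at [tau Z]. *)
move=> [Z' XZ' [ttau gZ']]; split => //; apply: (le_trans gZ').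
have mfst V : measurable V -> measurable (@fst 'cV[R]_n bool @^-1` V).
  by move=> mV; rewrite -[X in measurable X]setTI; exact: measurable_fst.
rewrite /marginal /pushforward.
apply: le_measure; rewrite ?inE.
- by apply: mfst; exact: mrec.
- by apply: mfst; exact: mrec.
move=> xy [Xx [delta [Dd Xd h]]]; split => //; exists delta; split => //.
exact: le_trans h.
Qed.

Theorem theorem3p1 (R : realType) (n k : nat)
    (X : set 'cV[R]_n) (mX : measurable X)
    (p : probability ('cV[R]_n * bool)%type R) (pX : supported_on X p)
    (M : 'M[R]_(k, n)) (b : 'cV[R]_k) (Delta0 : polyhedron M b 0)
    (Theta : Type) (g : Theta -> 'cV[R]_n -> R) (theta : Theta)
    (mg : measurable_fun X (g theta))
    (g01 : forall x, X x -> 0 <= g theta x <= 1)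
    (dg : ae_differentiable X (g theta))
    (A : 'cV[R]_n -> 'cV[R]_n) (mA : measurable_fun X A)
    (ADelta : forall x, X x -> polyhedron M b (A x))
    (AX : forall x, X x -> X (x + A x))
    (eps alpha : R) (eps0 : 0 < eps) (alpha0 : 0 < alpha)
    (N : nat) (N1 : (1 <= N)%N)
    (tauhat : N.-tuple ('cV[R]_n * bool)%type -> R)
    (PAC : PAC_threshold_estimator X (g theta) eps alpha tauhat)
    (mrecourse : forall Z : N.-tuple ('cV[R]_n * bool)%type, datasets X N Z ->
       measurable (recourse_set X (polyhedron M b)
         (threshold_classifier g (recourse_estimator theta A tauhat Z)))) :
  PARE X (polyhedron M b) p eps alpha
    (threshold_classifier g) (recourse_estimator theta A tauhat : N.-tuple _ -> _).
Proof.
have [mtau _ PACq] := PAC.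
(* [phi] is the identity on inputs outside [X], so that it preserves membership
   in [X] both ways and no null set has to be discarded. *)
pose phi (xy : 'cV[R]_n * bool) := (patch id X (fun x => x + A x) xy.1, true).
have phiE xy : X xy.1 -> phi xy = (xy.1 + A xy.1, true).
  by move=> Xx; rewrite /phi patchT// mem_set.
have Xphi xy : X (phi xy).1 <-> X xy.1.
  split=> [|Xx]; last by rewrite phiE//; exact: AX.
  by apply: contraPP => nXx; rewrite /phi patchC// inE.
have mphi : measurable_fun setT phi.
  apply: measurable_fun_pair => //; apply: measurableT_comp => //.
  by apply: measurable_fun_patch => //; exact: measurable_fun_addmx.
pose Phi : {mfun ('cV[R]_n * bool)%type >-> ('cV[R]_n * bool)%type} :=
  mfun_Sub (mem_set mphi).
have mD : measurable (datasets X N) := measurable_datasets mX.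
have DE Z : datasets X N (map_tuple phi Z) <-> datasets X N Z.
  by split=> XZ i; have := XZ i; rewrite tnth_map => /Xphi.
have mapE Z : datasets X N Z -> map_tuple phi Z = recourse_dataset A Z.
  move=> XZ; apply: eq_from_tnth => i; rewrite !tnth_map.
  exact: phiE.
have mmap := measurable_map_tuple (n := N) mphi.
have qX : supported_on X (distribution p Phi).
  rewrite /supported_on -[RHS]pX; congr (p _); apply/seteqP.
  by split=> xy [/Xphi Xx _]; split.
(* On datasets in [X] the translation agrees with [map_tuple phi], which is measurable
   everywhere. *)
have mtauR : measurable_fun (datasets X N)
    (tauhat \o recourse_dataset A (N := N)).
  apply: (eq_measurable_fun (tauhat \o map_tuple phi)).
    by move=> Z; rewrite inE => XZ /=; rewrite mapE.
  apply: (measurable_comp mD) mtau _; last exact: measurable_funTS.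
  by move=> _ [Z XZ <-]; exact/DE.
(* It remains to compare two events: after transport to [p], approximate correctness at [Z'] must
   imply approximate recourse at [Z]. *)
apply: (le_trans (PACq _ qX)).
have mgood : measurable (datasets X N `&` [set W |
    approximately_correct X (g theta) eps (distribution p Phi) (tauhat W)]).
  apply: (mtau mD [set t |
    approximately_correct X (g theta) eps (distribution p Phi) t]).
  apply: measurable_down_closed => s t; exact: approximately_correct_down.
rewrite product_power_distribution//.
apply: le_measure; rewrite ?inE.
- by rewrite -[X in measurable X]setTI; exact: mmap.
- exact: (measurable_good_datasets p eps mX mtauR mrecourse).
move=> Z [/DE XZ]; rewrite /= mapE// => AC; split => //.
apply: (le_trans AC).
rewrite -[X in (X <= _)%E]/(p (phi @^-1` _)) /marginal /pushforward.
apply: le_measure; rewrite ?inE.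
- rewrite -[X in measurable X]setTI; apply: (mphi) => //.
  exact: measurable_confidence_event.
- rewrite -[X in measurable X]setTI; apply: measurable_fst => //.
  exact: mrecourse.
(* The label of [phi xy] is [true], so [tg] says that the score at [xy.1 + A xy.1] reaches the
   threshold. *)
move=> xy [/Xphi Xx]; rewrite phiE// => tg; split => //.
exists (A xy.1); split; [exact: ADelta|exact: AX|exact: tg].
Qed.
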